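(* Let $q,b$ be complex numbers with $|q|<1$ and $b\neq -q^{-N}$ for any positive integer $N$. Then for all positive integers $m$ and $n$, $$\sum_{0\leq a_1\leq a_2\leq \dots \leq a_n}^{'}\frac{q^{m(a_1+a_2+\dots +a_n)}}{\prod_{j=0}^{n-1}\prod_{k=1}^{m+1}\left(1+bq^{jm+k+a_{j+1}}\right)}=\frac{1}{(q^m;q^m)_n\,(-bq;q)_{mn}},$$ where the sum is over all $n$-tuples $(a_1,\dots,a_n)$ of integers satisfying $0\leq a_1\leq a_2\leq\dots\leq a_n$, and the notation $\sum^{'}$ means that, for each $i$ with $1\le i\le n-1$ and $a_{i+1}=a_i$, the factor $1+bq^{im+1+a_i}$ (which arises in the double product both from $(j,k)=(i-1,m+1)$ and from $(j,k)=(i,1)$) is included just once in the denominator product.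
   Context: Notation: $(x;q)_0=1$ and $(x;q)_n=\prod_{j=0}^{n-1}(1-xq^{j})$ for $n\ge 1$; thus $(q^m;q^m)_n=\prod_{j=1}^{n}(1-q^{mj})$ and $(-bq;q)_{mn}=\prod_{j=1}^{mn}(1+bq^{j})$. The condition $b\ne -q^{-N}$ means $1+bq^N\neq 0$. Equivalently, the summand for the tuple $(a_1,\dots,a_n)$ in the primed sum is the displayed fraction multiplied by $\prod_{1\le i\le n-1,\ a_{i+1}=a_i}(1+bq^{im+1+a_i})$. *)

(* Defs.v *)
From mathcomp Require Import all_boot all_order all_algebra.
From mathcomp Require Export complex.
From mathcomp Require Import all_classical all_reals all_analysis.
From mathcomp.analysis.showcase Require Export summability.

Set Implicit Arguments.
Unset Strict Implicit.
Unset Printing Implicit Defensive.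

Import Order.TTheory GRing.Theory Num.Theory.
Import numFieldNormedType.Exports.
Local Open Scope ring_scope.

Definition qpoch (K : fieldType) (x q : K) (n : nat) : K :=
  \prod_(j < n) (1 - x * q ^+ j).

Definition monotone_tuple (n : nat) : choiceType :=
  {a : n.-tuple nat | sorted leq a}.

(* The 1-based component a_i is [nth 0 a (i - 1)].  When j > 0 and
   a_{j+1} = a_j, the factor of index (j, 1) coincides with the one of index
   (j - 1, m + 1): skipping the former keeps that repeated factor exactly
   once. *)
Definition primed_denominator (K : fieldType) (q b : K) (m n : nat)
    (a : n.-tuple nat) : K :=
  \prod_(j < n)
    \prod_(1 <= k < m.+2 |
           ~~ [&& 0 < j, k == 1 & nth 0 a j == nth 0 a j.-1]%N)
      (1 + b * q ^+ (j * m + k + nth 0 a j)%N).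

Definition primed_summand (K : fieldType) (q b : K) (m n : nat)
    (a : monotone_tuple n) : K :=
  q ^+ (m * \sum_(x <- val a) x)%N / primed_denominator q b m (val a).

(* Main.v *)
(* Write f(t) = 1 + b q^t.  The tuples are summed from the largest entry down.
   By induction, summing the last s entries (the first of which has index j,
   from 0) over all values at least the preceding entry c gives
     q^(s m c) / ((q^m; q^m)_s f(jm+c+2) ... f(jm+c+1+sm)):
   after multiplication by the weight of the entry a at index j, the summand
   telescopes, because f(v+l) - q^l f(v) = 1 - q^l, and at a = c the omitted
   factor f(jm+c+1) is exactly what closes the recursion.  Truncating all
   entries below M changes the iterated sum by O(|q|^M), and the truncated sums
   of absolute values are bounded uniformly in M, so the unordered sum exists
   and is the limit of the truncated sums. *)
Require Import Defs.
From mathcomp Require Import all_boot all_order all_algebra.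
From mathcomp Require Import all_classical all_reals all_analysis.
From mathcomp Require Import finmap zify ring lra.
Set Implicit Arguments.
Unset Strict Implicit.
Unset Printing Implicit Defensive.

Import Order.TTheory GRing.Theory Num.Theory.
Import numFieldNormedType.Exports.
Local Open Scope classical_set_scope.
Local Open Scope ring_scope.

(** * Enumeration of nondecreasing chains with bounded entries *)

Fixpoint chains (s c M : nat) : seq (seq nat) :=
  if s is s'.+1 then [seq a :: t | a <- index_iota c M, t <- chains s' a M]
  else [:: [::]].

Lemma mem_chains s c M t :
  (t \in chains s c M) =
  [&& size t == s, path leq c t & all (fun a => a < M)%N t].
Proof.
elim: s c t => [|s IHs] c t /=; first by case: t.
apply/allpairsPdep/idP => [[a [u [acM ut ->]]]|].
  move: acM ut; rewrite mem_index_iota IHs /= eqSS.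
  by move=> /andP[-> ->] /and3P[-> -> ->].
case: t => [//|a u] /=; rewrite eqSS => /and3P[su /andP[ca pu] /andP[aM uM]].
by exists a, u; split => //; rewrite ?mem_index_iota ?ca // IHs su pu.
Qed.

Lemma chains_uniq s c M : uniq (chains s c M).
Proof.
elim: s c => [//|s IHs] c /=.
apply: allpairs_uniq_dep => [|a _|]; [exact: iota_uniq|exact: IHs|].
by move=> [a u] [a' u'] _ _ /= [-> ->].
Qed.

Lemma big_chainsS (V : nmodType) s c M (F : seq nat -> V) :
  \sum_(t <- chains s.+1 c M) F t =
  \sum_(c <= a < M) \sum_(t <- chains s a M) F (a :: t).
Proof. exact: big_allpairs_dep. Qed.

(** * Chain weights and products of consecutive factors *)

Section Weights.
Variables (K : numFieldType) (q b : K) (m : nat).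

Definition factor (t : nat) : K := 1 + b * q ^+ t.

Definition fprod (lo len : nat) : K := \prod_(lo <= t < lo + len) factor t.

(** [skip] is set when the entry equals its predecessor: the factor k = 1 is then the last factor of
    the preceding block. *)
Definition block (skip : bool) (j a : nat) : K :=
  \prod_(1 <= k < m.+2 | ~~ (skip && (k == 1)%N)) factor (j * m + k + a)%N.

(* [c] is the entry preceding [t], whose head has index [j] in the tuple. *)
Fixpoint chain_weight (j c : nat) (t : seq nat) : K :=
  if t is a :: t' then
    q ^+ (m * a) / block (a == c) j a * chain_weight j.+1 a t'
  else 1.

(** The first entry has no predecessor, so nothing is skipped; [chain_weight 0 c] would skip a
    factor whenever that entry equals [c]. *)
Definition tuple_weight (t : seq nat) : K :=
  if t is a :: t' then q ^+ (m * a) / block false 0 a * chain_weight 1 a t'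
  else 1.

Lemma chain_weightE j c t :
  chain_weight j c t = q ^+ (m * \sum_(a <- t) a)
    / \prod_(i < size t) block (nth 0 t i == nth 0 (c :: t) i)%N (j + i) (nth 0 t i)%N.
Proof.
elim: t j c => [|a t IHt] j c /=.
  by rewrite big_nil big_ord0 muln0 expr0 divr1.
rewrite big_cons big_ord_recl IHt mulnDr exprD addn0 /=.
rewrite [X in _ = _ / (_ * X)](_ : _ = 
  \prod_(i < size t) block (nth 0 t i == nth 0 (a :: t) i)%N (j.+1 + i) (nth 0 t i)%N).
  by rewrite invfM mulrACA.
by apply: eq_bigr => i _ /=; rewrite addSnnS.
Qed.

Lemma primed_summandE n (a : monotone_tuple n) :
  primed_summand q b m a = tuple_weight (val (val a)).
Proof.
case: a => [[t /= st] +]; rewrite /primed_summand /primed_denominator /= => _.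
move: (st) => /eqP ?; subst n; case: t st => [|a t] st /=.
  by rewrite big_nil big_ord0 muln0 expr0 divr1.
rewrite chain_weightE big_cons big_ord_recl mulnDr exprD /= mulf_div.
congr (_ / (_ * _)); apply: eq_bigr => i _.
by apply: eq_bigl => k; rewrite [X in ~~ X]andbC.
Qed.

Lemma fprodS lo len : fprod lo len.+1 = fprod lo len * factor (lo + len).
Proof. by rewrite /fprod addnS big_nat_recr //= leq_addr. Qed.

Lemma fprodSl lo len : fprod lo len.+1 = factor lo * fprod lo.+1 len.
Proof. by rewrite /fprod addnS -addSn big_ltn // ltnS leq_addr. Qed.

Lemma fprodD lo k l : fprod lo (k + l) = fprod lo k * fprod (lo + k) l.
Proof. by rewrite /fprod addnA (big_cat_nat _ (n := lo + k)) ?leq_addr. Qed.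

Lemma fprod_qpoch l : fprod 1 l = qpoch (- (b * q)) q l.
Proof.
rewrite /fprod /qpoch add1n big_add1 big_mkord.
by apply: eq_bigr => i _; rewrite /factor exprS mulNr opprK mulrA.
Qed.

Lemma fprod_ord lo len : fprod lo len = \prod_(i < len) factor (lo + i).
Proof.
elim: len => [|len IH]; first by rewrite /fprod addn0 big_geq // big_ord0.
by rewrite fprodS IH big_ord_recr.
Qed.

Lemma blockF j a : block false j a = fprod (j * m + a).+1 m.+1.
Proof.
rewrite /block fprod_ord big_add1 big_mkord.
by apply: eq_big => // i _; congr factor; rewrite addnS addSn addnAC.
Qed.

Lemma blockT j a : block true j a = fprod (j * m + a).+2 m.
Proof.
rewrite /block fprod_ord big_ltn_cond //= big_nat_cond !big_add1 -big_nat_cond /=.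
rewrite big_mkord; apply: eq_big => // i _; congr factor.
by rewrite !addnS !addSn addnAC.
Qed.

(** * Telescoping identities and closed forms *)

Hypothesis factor_neq0 : forall t, (0 < t)%N -> factor t != 0.

Lemma fprod_neq0 lo len : (0 < lo)%N -> fprod lo len != 0.
Proof.
move=> lo0; rewrite fprod_ord; apply/prodf_neq0 => i _.
by rewrite factor_neq0 // addn_gt0 lo0.
Qed.

Definition tail_term (u l a : nat) : K := q ^+ (l * a) / fprod (u + a).+1 l.

(** The two denominators share all factors but the first, v, of one and the last, w, of the other;
    over the common denominator the numerator is a multiple of w - q^l v. *)
Lemma tail_term_diff u l a : (0 < l)%N ->
  tail_term u l a - tail_term u l a.+1 =
  (1 - q ^+ l) * (q ^+ (l * a) / fprod (u + a).+1 l.+1).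
Proof.
case: l => // l _; rewrite /tail_term addnS.
have P0 : fprod (u + a).+2 l != 0 by exact: fprod_neq0.
have v0 : factor (u + a).+1 != 0 by exact: factor_neq0.
have w0 : factor ((u + a).+2 + l) != 0 by exact: factor_neq0.
rewrite [fprod _ l.+2]fprodSl [fprod (u + a).+2 l.+1]fprodS fprodSl.
have wE : factor ((u + a).+2 + l) = 1 + q ^+ l.+1 * (factor (u + a).+1 - 1).
  by rewrite /factor addSnnS exprD; ring.
rewrite mulnS exprD.
set Q := q ^+ l.+1 in wE *; set A := q ^+ _; set P := fprod _ _ in P0 *.
set v := factor (u + a).+1 in v0 wE *; set w := factor _ in w0 wE *.
transitivity (A * (w - Q * v) / (v * P * w)); first by field; rewrite P0 v0 w0.
have -> : w - Q * v = 1 - Q by rewrite wE; ring.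
by field; rewrite P0 v0 w0.
Qed.

Hypothesis qm_neq1 : forall n, (0 < n)%N -> 1 - q ^+ (n * m) != 0.
Hypothesis m_gt0 : (0 < m)%N.

Let poch s := qpoch (q ^+ m) (q ^+ m) s.

Lemma poch_neq0 s : poch s != 0.
Proof.
apply/prodf_neq0 => i _.
by rewrite -exprS -exprM mulnC qm_neq1.
Qed.

Lemma pochS s : poch s.+1 = poch s * (1 - q ^+ (s.+1 * m)).
Proof. by rewrite /poch /qpoch big_ord_recr /= -exprS -exprM mulnC. Qed.

(** Limit, as [M] grows, of the sum of [chain_weight j c] over [chains s c M]; see
    [chain_sum_error]. *)
Definition tail_sum (j s c : nat) : K :=
  q ^+ (s * m * c) / (poch s * fprod (j * m + c).+2 (s * m)).

Definition tail_prim (j s a : nat) : K := tail_term (j * m) (s * m) a / poch s.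

(** The factors of the block and of [tail_sum] have consecutive indices, so they merge into the
    denominator of [tail_term_diff]. *)
Lemma tail_step_strict j s a :
  q ^+ (m * a) / block false j a * tail_sum j.+1 s a =
  tail_prim j s.+1 a - tail_prim j s.+1 a.+1.
Proof.
rewrite /tail_prim -mulrBl tail_term_diff ?muln_gt0 // pochS blockF /tail_sum.
have -> : fprod (j * m + a).+1 (s.+1 * m).+1 =
  fprod (j * m + a).+1 m.+1 * fprod (j.+1 * m + a).+2 (s * m).
  rewrite mulSn -[(m + _).+1]addSn fprodD; congr (_ * fprod _ _).
  by rewrite mulSn; lia.
have F1 : fprod (j * m + a).+1 m.+1 != 0 by exact: fprod_neq0.
have F2 : fprod (j.+1 * m + a).+2 (s * m) != 0 by exact: fprod_neq0.
have p0 := poch_neq0 s; have q1 := @qm_neq1 s.+1 isT.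
have -> : (s.+1 * m * a = m * a + s * m * a)%N by rewrite mulSn mulnDl.
rewrite exprD.
by field; rewrite F1 F2 p0 q1.
Qed.

(** Without the skipped factor both terms have the same [fprod], and the numerators add up by (1 -
    Q) + Q = 1 with Q = q^((s+1)m). *)
Lemma tail_step_eq j s c :
  q ^+ (m * c) / block true j c * tail_sum j.+1 s c + tail_prim j s.+1 c.+1 =
  tail_sum j s.+1 c.
Proof.
rewrite blockT /tail_sum /tail_prim /tail_term addnS pochS.
have -> : fprod (j * m + c).+2 (s.+1 * m) =
  fprod (j * m + c).+2 m * fprod (j.+1 * m + c).+2 (s * m).
  rewrite mulSn fprodD; congr (_ * fprod _ _).
  by rewrite mulSn; lia.
have F1 : fprod (j * m + c).+2 m != 0 by exact: fprod_neq0.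
have F2 : fprod (j.+1 * m + c).+2 (s * m) != 0 by exact: fprod_neq0.
have p0 := poch_neq0 s; have q1 := @qm_neq1 s.+1 isT.
have E : (s.+1 * m * c = m * c + s * m * c)%N by rewrite mulSn mulnDl.
rewrite mulnS exprD E exprD.
by field; rewrite F1 F2 p0 q1.
Qed.

(** The term a = c is absorbed by [tail_step_eq]; the others telescope, leaving the truncation error
    at [M]. *)
Lemma tail_sum_rec j s c M : (c < M)%N ->
  \sum_(c <= a < M) q ^+ (m * a) / block (a == c) j a * tail_sum j.+1 s a =
  tail_sum j s.+1 c - tail_prim j s.+1 M.
Proof.
move=> cM; rewrite big_ltn // eqxx -tail_step_eq -addrA; congr (_ + _).
rewrite (eq_big_nat _ _ (F2 := fun a => - tail_prim j s.+1 a.+1 - - tail_prim j s.+1 a)).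
  by rewrite telescope_sumr // opprK addrC.
move=> a /andP[ca _]; rewrite gtn_eqF // tail_step_strict opprK addrC //.
Qed.

(** With no skipped factor the telescoping starts at 0, where [tail_prim 0 s.+1] is the claimed
    value. *)
Lemma first_sum_rec s M :
  \sum_(0 <= a < M) q ^+ (m * a) / block false 0 a * tail_sum 1 s a =
  (poch s.+1 * qpoch (- (b * q)) q (m * s.+1))^-1 - tail_prim 0 s.+1 M.
Proof.
rewrite (eq_big_nat _ _ (F2 := fun a => - tail_prim 0 s.+1 a.+1 - - tail_prim 0 s.+1 a)).
  rewrite telescope_sumr // opprK addrC; congr (_ - _).
  rewrite /tail_prim /tail_term muln0 expr0 mul0n addn0 fprod_qpoch mulnC.
  by rewrite invfM mul1r mulrC mulnC.
by move=> a _; rewrite tail_step_strict opprK addrC.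
Qed.


(** * Uniform bounds and truncation errors *)

Hypothesis q_lt1 : `|q| < 1.
Variable D : K.
Hypothesis D_ge1 : 1 <= D.
Hypothesis factorV_le : forall t, (0 < t)%N -> `|(factor t)^-1| <= D.

Let D_ge0 : 0 <= D. Proof. exact: le_trans D_ge1. Qed.

Lemma fprodV_le lo len : (0 < lo)%N -> `|(fprod lo len)^-1| <= D ^+ len.
Proof.
move=> lo0; elim: len => [|len IH].
  by rewrite /fprod addn0 big_geq // invr1 normr1 expr0.
rewrite fprodS invfM normrM exprSr ler_pM // factorV_le //.
by rewrite addn_gt0 lo0.
Qed.

Lemma norm_expq_le k a : (0 < k)%N -> `|q ^+ (k * a)| <= `|q| ^+ a.
Proof.
move=> k0; rewrite normrX ler_wiXn2l ?normr_ge0 ?(ltW q_lt1) //.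
by rewrite leq_pmull.
Qed.

Lemma blockV_le skip j a : `|(block skip j a)^-1| <= D ^+ m.+1.
Proof.
case: skip; last by rewrite blockF fprodV_le.
by rewrite blockT (le_trans (fprodV_le _ _)) // ler_weXn2l.
Qed.

Lemma norm_step_le skip j a :
  `|q ^+ (m * a) / block skip j a| <= D ^+ m.+1 * `|q| ^+ a.
Proof. by rewrite normrM mulrC ler_pM // ?blockV_le // norm_expq_le. Qed.

Lemma sum_expq_le c M : \sum_(c <= a < M) `|q| ^+ a <= (1 - `|q|)^-1.
Proof.
have q1 : 0 < 1 - `|q| by rewrite subr_gt0.
rewrite -[leRHS]mul1r ler_pdivlMr // mulr_suml.
have [cM|/ltnW Mc] := leqP c M; last by rewrite big_geq.
rewrite (telescope_sumr_eq (fun a => - `|q| ^+ a)) //.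
  rewrite opprK addrC (le_trans (y := `|q| ^+ c)) //.
    by rewrite gerBl exprn_ge0.
  by rewrite exprn_ile1 // ltW.
by move=> a _; rewrite exprS; ring.
Qed.

Let step_bound : K := D ^+ m.+1 / (1 - `|q|).

Let step_bound_ge0 : 0 <= step_bound.
Proof. by rewrite divr_ge0 ?exprn_ge0 // subr_ge0 ltW. Qed.

Lemma sum_step_le j c M (skip : nat -> bool) :
  \sum_(c <= a < M) `|q ^+ (m * a) / block (skip a) j a| <=
  step_bound.
Proof.
apply: (le_trans (y := \sum_(c <= a < M) D ^+ m.+1 * `|q| ^+ a)).
  by apply: ler_sum => a _; exact: norm_step_le.
by rewrite -mulr_sumr ler_wpM2l ?exprn_ge0 // sum_expq_le.
Qed.

(** Each entry contributes at most [step_bound], whatever its index and predecessor. *)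
Lemma sum_norm_chain_weight s j c M :
  \sum_(t <- chains s c M) `|chain_weight j c t| <= step_bound ^+ s.
Proof.
elim: s j c => [|s IHs] j c; first by rewrite /= big_seq1 normr1 expr0.
rewrite big_chainsS exprS.
apply: (le_trans _ (ler_wpM2r _ (sum_step_le j c M (fun a => a == c)))); last first.
  by apply: le_trans (IHs j c); exact: sumr_ge0.
rewrite mulr_suml; apply: ler_sum => a _ /=.
under eq_bigr do rewrite normrM.
by rewrite -mulr_sumr ler_wpM2l.
Qed.

Lemma sum_norm_tuple_weight n M :
  \sum_(t <- chains n 0 M) `|tuple_weight t| <= step_bound ^+ n.
Proof.
case: n => [|n]; first by rewrite /= big_seq1 normr1 expr0.
rewrite big_chainsS exprS.
apply: (le_trans _ (ler_wpM2r _ (sum_step_le 0 0 M (fun=> false)))); last first.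
  by apply: le_trans (sum_norm_chain_weight n 0 0 M); exact: sumr_ge0.
rewrite mulr_suml; apply: ler_sum => a _ /=.
under eq_bigr do rewrite normrM.
by rewrite -mulr_sumr ler_wpM2l // sum_norm_chain_weight.
Qed.

Lemma tail_prim_le s : exists2 C, 0 <= C &
  forall j M, `|tail_prim j s.+1 M| <= C * `|q| ^+ M.
Proof.
exists (D ^+ (s.+1 * m) * `|(poch s.+1)^-1|) => [|j M].
  by rewrite mulr_ge0 ?exprn_ge0.
rewrite /tail_prim /tail_term !normrM [leRHS]mulrAC ler_wpM2r // mulrC.
by rewrite ler_pM ?fprodV_le // norm_expq_le // muln_gt0.
Qed.

(** [C] is uniform in [j] and [c], so the induction hypothesis applies to every inner sum. The new
    error is the inner errors, weighted by at most [step_bound], plus the truncation of the head. *)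
Lemma chain_sum_error s : exists2 C, 0 <= C & forall j c M, (c < M)%N ->
  `|\sum_(t <- chains s c M) chain_weight j c t - tail_sum j s c|
    <= C * `|q| ^+ M.
Proof.
elim: s => [|s [C C0 IHs]].
  exists 0 => // j c M _; rewrite /= big_seq1 /tail_sum /poch /qpoch /fprod.
  by rewrite big_ord0 mul0n addn0 big_geq // expr0 mulr1 divr1 subrr normr0 mul0r.
have [E E0 primE] := tail_prim_le s.
exists (step_bound * C + E) => [|j c M cM].
  by rewrite addr_ge0 // mulr_ge0.
have -> : tail_sum j s.+1 c =
    \sum_(c <= a < M) q ^+ (m * a) / block (a == c) j a * tail_sum j.+1 s a
      + tail_prim j s.+1 M by rewrite tail_sum_rec // subrK.
rewrite big_chainsS opprD addrA -sumrB mulrDl.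
apply: (le_trans (ler_normB _ _)); apply: lerD => //.
apply: (le_trans (ler_norm_sum _ _ _)); rewrite -mulrA.
apply: (le_trans _ (ler_wpM2r _ (sum_step_le j c M (fun a => a == c)))); last first.
  by rewrite mulr_ge0 // exprn_ge0.
rewrite mulr_suml !big_nat; apply: ler_sum => a /andP[_ aM] /=.
by rewrite -mulr_sumr -mulrBr normrM ler_wpM2l // IHs.
Qed.

Lemma tuple_sum_error s : exists2 C, 0 <= C & forall M,
  `|\sum_(t <- chains s.+1 0 M) tuple_weight t -
    (poch s.+1 * qpoch (- (b * q)) q (m * s.+1))^-1| <= C * `|q| ^+ M.
Proof.
have [C C0 HC] := chain_sum_error s.
have [E E0 primE] := tail_prim_le s.
exists (step_bound * C + E) => [|M].
  by rewrite addr_ge0 // mulr_ge0.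
have -> : (poch s.+1 * qpoch (- (b * q)) q (m * s.+1))^-1 =
    \sum_(0 <= a < M) q ^+ (m * a) / block false 0 a * tail_sum 1 s a
      + tail_prim 0 s.+1 M by rewrite first_sum_rec subrK.
rewrite big_chainsS opprD addrA -sumrB mulrDl.
apply: (le_trans (ler_normB _ _)); apply: lerD => //.
apply: (le_trans (ler_norm_sum _ _ _)); rewrite -mulrA.
apply: (le_trans _ (ler_wpM2r _ (sum_step_le 0 0 M (fun=> false)))); last first.
  by rewrite mulr_ge0 // exprn_ge0.
rewrite mulr_suml !big_nat; apply: ler_sum => a /andP[_ aM] /=.
by rewrite -mulr_sumr -mulrBr normrM ler_wpM2l // HC.
Qed.

End Weights.

(** * Unordered sums from an exhausting sequence of finite sets *)

Lemma sum_fset_sub (V : nmodType) (I : choiceType) (F : I -> V) (A B : {fset I}) :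
  (A `<=` B)%fset ->
  \sum_(i <- B) F i = \sum_(i <- A) F i + \sum_(i <- B | i \notin A) F i.
Proof.
move=> /fsubsetP AB; rewrite (bigID (mem A)) /=; congr (_ + _).
rewrite -big_filter; apply: perm_big; apply: uniq_perm => //.
  by rewrite filter_uniq.
move=> i; rewrite mem_filter; apply/andP/idP => [[]//|iA]; split => //.
exact: AB.
Qed.

(** The order on [R[i]] is partial; this moves nonnegative quantities to [R], where suprema
    exist. *)
Lemma Re_normK (R : realType) (z : R[i]) : 0 <= z -> (complex.Re z)%:C%C = z.
Proof. by move=> /ger0_real /RRe_real. Qed.

Lemma partial_sum_cvg (R : realType) (I : choiceType) (x : I -> R[i])
    (B : nat -> {fset I}) (C L : R[i]) :
  (forall A, \forall M \near \oo, (A `<=` B M)%fset) ->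
  (forall M, \sum_(i <- B M) `|x i| <= C) ->
  (\sum_(i <- B M) x i @[M --> \oo] --> (L : R[i]^o)) ->
  partial_sum x @ totally --> (L : R[i]^o).
Proof.
move=> exhB leC cvgB.
have psE A : partial_sum x A = \sum_(i <- A) x i.
  by rewrite /partial_sum big_seq_fsetE.
pose g (A : {fset I}) : R := complex.Re (\sum_(i <- A) `|x i|).
have gE A : (g A)%:C%C = \sum_(i <- A) `|x i|.
  by rewrite Re_normK // sumr_ge0.
have g_ub A : g A <= complex.Re C.
  have [M _ /(_ _ (leqnn M)) AB] := exhB A.
  have : \sum_(i <- A) `|x i| <= C.
    by rewrite (le_trans _ (leC M)) // (sum_fset_sub _ AB) lerDl sumr_ge0.
  by rewrite -gE lecE => /andP[].
have gsup : has_sup (range g).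
  by split; [exists (g fset0); exists fset0|exists (complex.Re C) => _ [A _ <-]].
have ? : ProperFilter (@totally I) := totally_filter.
apply/(cvgrPdist_lt (V := R[i]^o)) => e e0.
have eE : (complex.Re e)%:C%C = e by apply/Re_normK/ltW.
have eR0 : 0 < complex.Re e / 2 by rewrite divr_gt0 // -ltcR eE.
(* Beyond [A0], which nearly attains the supremum of the absolute sums, any further terms have total
   norm below e / 2. *)
have [_ [A0 _ <-] A0sup] := sup_adherent eR0 gsup.
exists A0 => // A /= A0A; rewrite psE.
(* [A] is compared with [L] through a set [B M] that contains it and whose sum is already close to
   [L]. *)
have [M [AB LB]] : exists M, (A `<=` B M)%fset /\ `|L - \sum_(i <- B M) x i| < e / 2.
  have e20 : 0 < e / 2 by rewrite divr_gt0.
  have /(cvgrPdist_lt (V := R[i]^o)) /(_ _ e20) cvgBe := cvgB.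
  have [M []] := filter_ex (filterI (exhB A) cvgBe).
  by exists M.
rewrite -(subrK (\sum_(i <- B M) x i) L) -addrA [ltRHS]splitr.
apply: (le_lt_trans (ler_normD _ _)); apply: ltrD => //.
rewrite (sum_fset_sub _ AB) addrC addKr.
apply: (le_lt_trans (ler_norm_sum _ _ _)).
have -> : \sum_(i <- B M | i \notin A) `|x i| = (g (B M) - g A)%:C%C.
  by rewrite rmorphB /= !gE (sum_fset_sub _ AB) addrC addKr.
have -> : e / 2 = (complex.Re e / 2)%:C%C by rewrite rmorphM fmorphV /= eE rmorph_nat.
rewrite ltcR.
have gBM : g (B M) <= sup (range g) by apply: ub_le_sup; [case: gsup|exists (B M)].
have gA : g A0 <= g A.
  by rewrite -lecR !gE (sum_fset_sub _ A0A) lerDl sumr_ge0.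
lra.
Qed.

Lemma expr_cvg0 (R : realType) (q : R[i]) : `|q| < 1 ->
  `|q| ^+ n @[n --> \oo] --> (0 : R[i]^o).
Proof.
move=> q1; set r := complex.Re `|q|.
have rE : r%:C%C = `|q| by rewrite Re_normK.
have r0 : 0 <= r by rewrite -ler0c rE.
have r1 : `|r| < 1 by rewrite ger0_norm // -ltcR rE.
apply/(cvgrPdist_lt (V := R[i]^o)) => e e0.
have eE : (complex.Re e)%:C%C = e by apply/Re_normK/ltW.
have eR0 : 0 < complex.Re e by rewrite -ltcR eE.
have /cvgrPdist_lt /(_ _ eR0) := cvg_expr r1.
apply: filterS => n; rewrite !sub0r !normrN -rE -rmorphXn /=.
by rewrite !ger0_norm ?ler0c ?exprn_ge0 // -{2}eE ltcR.
Qed.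

Lemma factorV_bounded (R : realType) (q b : R[i]) : `|q| < 1 ->
  exists2 D : R[i], 1 <= D & forall t, `|(1 + b * q ^+ t)^-1| <= D.
Proof.
move=> q1.
have [T _ HT] : \forall t \near \oo, `|b * q ^+ t| < 2^-1.
  (* The + 1 keeps the threshold meaningful when b = 0. *)
  have b0 : 0 < (2 * (`|b| + 1))^-1 by rewrite invr_gt0 mulr_gt0 // ltr_wpDl.
  have /(cvgrPdist_lt (V := R[i]^o)) /(_ _ b0) := expr_cvg0 q1.
  apply: filterS => t; rewrite sub0r normrN normrX normr_id => qt.
  rewrite normrM normrX.
  apply: (le_lt_trans (y := (`|b| + 1) * `|q| ^+ t)).
    by rewrite ler_wpM2r ?exprn_ge0 // lerDl.
  by rewrite mulrC -ltr_pdivlMr ?ltr_wpDl // -invfM.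
(* From [T] on the factor has norm at least 1/2, hence inverse at most 2; the sum covers the
   finitely many earlier indices. A vanishing factor, possible at t = 0, has inverse 0 by
   convention. *)
exists (2 + \sum_(t < T) `|(1 + b * q ^+ t)^-1|) => [|t].
  by rewrite (le_trans (y := 2)) ?ler1n // lerDl sumr_ge0.
have [Tt|tT] := leqP T t; last first.
  rewrite (bigD1 (Ordinal tT)) //= addrCA lerDl addr_ge0 //.
  exact: sumr_ge0.
apply: (le_trans (y := 2)); last by rewrite lerDl sumr_ge0.
have := HT _ Tt; set z := b * _ => /= z2.
have z2' : 2^-1 <= `|1 + z|.
  rewrite (le_trans _ (lerB_normD 1 z)) // normr1 lerBrDr.
  by rewrite [leRHS]splitr div1r lerD2l ltW.
by rewrite normfV -[leRHS]invrK lef_pV2 ?posrE ?invr_gt0 // (lt_le_trans _ z2').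
Qed.

(** * Boxes of tuples and the conclusion *)

Definition chain_box (n M : nat) : {fset monotone_tuple n} :=
  [fset a in pmap insub (pmap insub (chains n 0 M) : seq (n.-tuple nat))]%fset.

Lemma mem_chain_box n M (a : monotone_tuple n) :
  (a \in chain_box n M) = all (fun x => x < M)%N (val (val a)).
Proof.
rewrite inE /= !mem_pmap_sub mem_chains size_tuple eqxx /=.
by case: a => [[[|x t] ?] /= st] //; rewrite st.
Qed.

(** The two [insub] discard nothing: every chain from 0 has length [n] and is sorted. *)
Lemma sum_chain_box (V : nmodType) n M (F : seq nat -> V) :
  \sum_(a <- chain_box n M) F (val (val a)) = \sum_(t <- chains n 0 M) F t.
Proof.
rewrite -(big_map (fun a : monotone_tuple n => val (val a)) xpredT F).
apply: perm_big; apply: uniq_perm; rewrite ?chains_uniq //.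
  by rewrite map_inj_uniq // => a a' /val_inj /val_inj.
move=> t; rewrite mem_chains; apply/mapP/idP => [[a]|/and3P[st pt tM]].
  rewrite mem_chain_box => aM ->; rewrite aM size_tuple eqxx andbT /=.
  by case: a {aM} => -[[|x t'] ?] st /=.
have srt : sorted leq t by case: (t) pt => //= x u /andP[].
by exists (Sub (Tuple st) srt : monotone_tuple n); rewrite ?mem_chain_box.
Qed.

(* The sum over the tuples is unordered: its finite partial sums converge along
   the filter of finite sets of tuples ordered by inclusion.  The
   annotation R[i]^o only selects the usual norm topology on R[i]. *)
Theorem lemma4 (R : realType) (q b : R[i]) (m n : nat)
    (hq : `|q| < 1)
    (hb : forall N : nat, (0 < N)%N -> 1 + b * q ^+ N != 0)
    (hm : (0 < m)%N) (hn : (0 < n)%N) :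
  partial_sum (primed_summand q b m (n := n)) @ totally -->
    ((qpoch (q ^+ m) (q ^+ m) n * qpoch (- (b * q)) q (m * n)%N)^-1 : R[i]^o).
Proof.
have [D D1 factorV_le] := factorV_bounded b hq.
have qm_neq1 k : (0 < k)%N -> 1 - q ^+ (k * m) != 0.
  move=> k0; rewrite subr_eq0 eq_sym; apply/eqP => qk1.
  have : `|q ^+ (k * m)| < 1 by rewrite normrX exprn_ilt1 // -lt0n muln_gt0 k0.
  by rewrite qk1 normr1 ltxx.
have factorV_le' t (_ : (0 < t)%N) := factorV_le t.
case: n hn => // n' _.
apply: (partial_sum_cvg (B := chain_box n'.+1)
    (C := (D ^+ m.+1 / (1 - `|q|)) ^+ n'.+1)).
(* Any [M] above all entries of all tuples in [A] will do. *)
- move=> A; exists (\max_(a <- A) \max_(x <- val (val a)) x).+1 => // M /= AM.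
  apply/fsubsetP => a aA; rewrite mem_chain_box; apply/allP => x xa.
  apply: leq_trans AM; rewrite ltnS.
  apply: leq_trans (leq_bigmax_seq _ aA isT).
  exact: (leq_bigmax_seq (F := id) x xa isT).
- move=> M; under eq_bigr do rewrite primed_summandE.
  rewrite (sum_chain_box _ _ (fun t => `|tuple_weight q b m t|)).
  exact: sum_norm_tuple_weight.
have [C C0 HC] := tuple_sum_error hb qm_neq1 hm hq D1 factorV_le' n'.
apply/(cvgrPdist_lt (V := R[i]^o)) => e e0.
(* [C] may be 0, so e is divided by C + 1. *)
have eC0 : 0 < e / (C + 1) by rewrite divr_gt0 // ltr_wpDl.
have /(cvgrPdist_lt (V := R[i]^o)) /(_ _ eC0) := expr_cvg0 hq.
apply: filterS => M; rewrite sub0r normrN normrX normr_id => qM.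
under eq_bigr do rewrite primed_summandE.
rewrite sum_chain_box distrC (le_lt_trans (HC M)) //.
apply: (le_lt_trans (y := (C + 1) * `|q| ^+ M)).
  by rewrite ler_wpM2r ?exprn_ge0 // lerDl.
by rewrite mulrC -ltr_pdivlMr ?ltr_wpDl.
Qed.
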